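(* For every $\mathbf s\in\mathbb{R}^8$ with $\mathbf s\neq\mathbf 0$ and $\|\mathbf s\|_\infty<0.02614$, one has $$\operatorname{width}_{\Lambda(\mathbf 0)}(\Delta)>\operatorname{width}_{\Lambda(\mathbf s)}(\Delta).$$
   Context: $\Delta=\operatorname{conv}(a_1,a_2,a_3,a_4)\subset\mathbb{R}^3$ with $a_1=(2+\sqrt2,\ \sqrt2,\ 2+\sqrt2)$, $a_2=(-\sqrt2,\ 2+\sqrt2,\ -2-\sqrt2)$, $a_3=(-2-\sqrt2,\ -\sqrt2,\ 2+\sqrt2)$, $a_4=(\sqrt2,\ -2-\sqrt2,\ -2-\sqrt2)$. For $\mathbf t=(t_{11},t_{12},t_{21},t_{22},t_{31},t_{32},t_{41},t_{42})\in\mathbb{R}^8$ put $p_1(\mathbf t)=(-1,-1,-1)+(t_{11},t_{12},t_{13})$, $p_2(\mathbf t)=(1,-1,1)+(t_{21},t_{22},t_{23})$, $p_3(\mathbf t)=(1,1,-1)+(t_{31},t_{32},t_{33})$, $p_4(\mathbf t)=(-1,1,1)+(t_{41},t_{42},t_{43})$, where $t_{13}=-\frac{(2+\sqrt2)t_{11}+\sqrt2\,t_{12}}{2}$, $t_{23}=\frac{-\sqrt2\,t_{21}+(2+\sqrt2)t_{22}}{2}$, $t_{33}=\frac{(2+\sqrt2)t_{31}+\sqrt2\,t_{32}}{2}$, $t_{43}=\frac{\sqrt2\,t_{41}-(2+\sqrt2)t_{42}}{2}$. New coordinates $\mathbf s=(s_1^{(h)},s_1^{(v)},s_2^{(h)},s_2^{(v)},s_3^{(h)},s_3^{(v)},s_4^{(h)},s_4^{(v)})$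 on $\mathbb{R}^8$ are defined by the invertible linear change of variables $s_1^{(h)}=\frac14\big((\sqrt2-1)t_{11}-t_{12}\big)$, $s_1^{(v)}=\frac14\big(-t_{11}+(1-\sqrt2)t_{12}\big)$, $s_2^{(h)}=\frac14\big(t_{21}+(\sqrt2-1)t_{22}\big)$, $s_2^{(v)}=\frac14\big((\sqrt2-1)t_{21}-t_{22}\big)$, $s_3^{(h)}=\frac14\big((1-\sqrt2)t_{31}+t_{32}\big)$, $s_3^{(v)}=\frac14\big(t_{31}+(\sqrt2-1)t_{32}\big)$, $s_4^{(h)}=\frac14\big(-t_{41}+(1-\sqrt2)t_{42}\big)$, $s_4^{(v)}=\frac14\big((1-\sqrt2)t_{41}+t_{42}\big)$. Let $\mathbf t(\mathbf s)$ be the inverse linear map. $\Lambda(\mathbf s)$ denotes the affine lattice generated by $p_1(\mathbf t(\mathbf s)),\dots,p_4(\mathbf t(\mathbf s))$, i.e. the set of their integer affine combinations (integer coefficients summing to $1$). For an affine lattice $\Lambda$, $\vec\Lambda=\Lambda-\Lambda$ is the associated linear lattice and $\vec\Lambda^*$ its dual lattice (linear functionals taking integer values on $\vec\Lambda$). For a convex body $K$ and a linear functional $f$, $\operatorname{width}(K,f)$ is the length of the segment $f(K)$, and $\operatorname{width}_{\Lambda}(K)$ is the minimum of $\operatorname{width}(K,f)$ over all nonzero $f\in\vec\Lambda^*$. *)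

(* Defs.v *)
From HB Require Import structures.
From mathcomp Require Import all_boot all_order all_algebra.
From mathcomp Require Import ring lra.
From mathcomp Require Import boolp classical_sets reals.
From mathcomp Require Import topology normedtype.

Set Implicit Arguments.
Unset Strict Implicit.
Unset Printing Implicit Defensive.

Import Order.TTheory GRing.Theory Num.Theory.
Import numFieldNormedType.Exports.

Local Open Scope classical_set_scope.
Local Open Scope ring_scope.

Section Lattices.
Variables (R : realType) (E : lmodType R).
Implicit Types (n : nat) (K L : set E) (f : {scalar E}).

Definition conv_hull n (p : 'I_n -> E) : set E :=
  [set x | exists w : 'I_n -> R,
     [/\ forall i, 0 <= w i, \sum_i w i = 1 & x = \sum_i w i *: p i]].

Definition affine_lattice n (p : 'I_n -> E) : set E :=
  [set x | exists c : 'I_n -> int, \sum_i c i = 1 /\ x = \sum_i p i *~ c i].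

Definition linear_lattice L : set E := [set x - y | x in L & y in L].

Definition dual_lattice L : set {scalar E} :=
  [set f | forall v, linear_lattice L v -> f v \is a Num.int].

Definition width K f : R := sup (f @` K) - inf (f @` K).

Definition dual_widths L K : set R :=
  [set width K f | f in [set f | dual_lattice L f /\ (f : E -> R) <> (fun=> 0)]].

(* The infimum is taken so that the width is total; it is the minimum whenever
   the minimum exists (lattice_width_min), in particular when L is a genuine
   affine lattice and K is full-dimensional. *)
Definition lattice_width L K : R := inf (dual_widths L K).

Lemma lattice_width_min L K (w : R) :
  dual_widths L K w -> lbound (dual_widths L K) w -> lattice_width L K = w.
Proof.
move=> Lw lbw; apply/eqP; rewrite eq_le; apply/andP; split.
- by apply: ge_inf => //; exists w.
- by apply: lb_le_inf => //; exists w.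
Qed.

End Lattices.

Section Tetrahedron.
Variable R : realType.

Local Notation sqrt2 := (Num.sqrt 2 : R).

Definition vec3 (x y z : R) : 'rV[R]_3 := \row_(k < 3) [:: x; y; z]`_k.

Definition a_vertex (i : 'I_4) : 'rV[R]_3 :=
  nth 0 [:: vec3 (2 + sqrt2) sqrt2 (2 + sqrt2);
            vec3 (- sqrt2) (2 + sqrt2) (- 2 - sqrt2);
            vec3 (- 2 - sqrt2) (- sqrt2) (2 + sqrt2);
            vec3 sqrt2 (- 2 - sqrt2) (- 2 - sqrt2)] i.

Definition Delta : set 'rV[R]_3 := conv_hull a_vertex.

(* t_{i1} and t_{i2} are the entries 2(i-1) and 2(i-1)+1 of t; likewise
   s_i^{(h)} and s_i^{(v)} for s. *)
Definition p_point (t : 'rV[R]_8) (i : 'I_4) : 'rV[R]_3 :=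
  let t11 := t 0 0 in let t12 := t 0 1 in
  let t21 := t 0 2 in let t22 := t 0 3 in
  let t31 := t 0 4 in let t32 := t 0 5 in
  let t41 := t 0 6 in let t42 := t 0 7 in
  let t13 := - (((2 + sqrt2) * t11 + sqrt2 * t12) / 2) in
  let t23 := (- sqrt2 * t21 + (2 + sqrt2) * t22) / 2 in
  let t33 := ((2 + sqrt2) * t31 + sqrt2 * t32) / 2 in
  let t43 := (sqrt2 * t41 - (2 + sqrt2) * t42) / 2 in
  nth 0 [:: vec3 (-1) (-1) (-1) + vec3 t11 t12 t13;
            vec3 1 (-1) 1 + vec3 t21 t22 t23;
            vec3 1 1 (-1) + vec3 t31 t32 t33;
            vec3 (-1) 1 1 + vec3 t41 t42 t43] i.

Definition s_of_t (t : 'rV[R]_8) : 'rV[R]_8 :=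
  let t11 := t 0 0 in let t12 := t 0 1 in
  let t21 := t 0 2 in let t22 := t 0 3 in
  let t31 := t 0 4 in let t32 := t 0 5 in
  let t41 := t 0 6 in let t42 := t 0 7 in
  \row_(k < 8)
    [:: 1 / 4 * ((sqrt2 - 1) * t11 - t12);
        1 / 4 * (- t11 + (1 - sqrt2) * t12);
        1 / 4 * (t21 + (sqrt2 - 1) * t22);
        1 / 4 * ((sqrt2 - 1) * t21 - t22);
        1 / 4 * ((1 - sqrt2) * t31 + t32);
        1 / 4 * (t31 + (sqrt2 - 1) * t32);
        1 / 4 * (- t41 + (1 - sqrt2) * t42);
        1 / 4 * ((1 - sqrt2) * t41 + t42)]`_k.

Definition t_of_s (s : 'rV[R]_8) : 'rV[R]_8 := s *m invmx (lin1_mx s_of_t).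

Definition Lambda (s : 'rV[R]_8) : set 'rV[R]_3 :=
  affine_lattice (p_point (t_of_s s)).

Fact s_of_t_is_linear : linear s_of_t.
Proof.
move=> c u v; apply/rowP => -[k klt]; rewrite !mxE.
by do 8![case: k klt => [|k] klt /=; first by rewrite ?mxE; ring].
Qed.

HB.instance Definition _ :=
  GRing.isLinear.Build R 'rV[R]_8 'rV[R]_8 _ s_of_t s_of_t_is_linear.

Lemma s_of_t_unit : lin1_mx s_of_t \in unitmx.
Proof.
rewrite -row_free_unit; apply: inj_row_free => t; rewrite mul_rV_lin1 => t0.
have E k := congr1 (fun u : 'rV[R]_8 => u 0 k) t0.
have r0 : sqrt2 ^+ 2 = 2 by rewrite sqr_sqrtr.
have H x y : (sqrt2 - 1) * x - y = 0 -> - x + (1 - sqrt2) * y = 0 ->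
    x = 0 /\ y = 0.
  move=> e1 e2; have ye : y = (sqrt2 - 1) * x by lra.
  have x0 : x = 0.
    move: e2; rewrite ye => e2.
    have : x * (1 + (sqrt2 - 1) ^+ 2) = 0 by lra.
    move/eqP; rewrite mulf_eq0 => /orP[/eqP//|/eqP h].
    by have := sqr_ge0 (sqrt2 - 1); lra.
  by split=> //; move: e1; rewrite x0 mulr0 sub0r => /eqP; rewrite oppr_eq0 => /eqP.
move: (E 0) (E 1) (E 2) (E 3) (E 4) (E 5) (E 6) (E 7).
rewrite !mxE /= => e0 e1 e2 e3 e4 e5 e6 e7.
have [h0 h1] : t 0 0 = 0 /\ t 0 1 = 0 by apply: H; lra.
have [h2 h3] : t 0 2 = 0 /\ t 0 3 = 0 by apply: H; lra.
have [h4 h5] : t 0 4 = 0 /\ t 0 5 = 0 by apply: H; lra.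
have [h6 h7] : t 0 6 = 0 /\ t 0 7 = 0 by apply: H; lra.
apply/rowP => -[k klt]; rewrite mxE.
do 8![case: k klt => [|k] klt /=; first by
  match goal with h : _ = 0 |- _ => rewrite -[RHS]h; congr (t _ _);
    exact: val_inj end].
by [].
Qed.

Lemma s_of_tK : cancel s_of_t t_of_s.
Proof. by move=> t; rewrite /t_of_s -mul_rV_lin1 mulmxK // s_of_t_unit. Qed.

Lemma t_of_sK : cancel t_of_s s_of_t.
Proof. by move=> s; rewrite -mul_rV_lin1 mulmxKV // s_of_t_unit. Qed.

End Tetrahedron.

(* Main.v *)
From Stdlib Require Import ZArith.
From HB Require Import structures.
Require Import Defs.
From mathcomp Require Import all_boot all_order all_algebra.
From mathcomp Require Import boolp classical_sets reals topology normedtype.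
From mathcomp Require Import ssrZ zify ring lra.
Import Order.TTheory GRing.Theory Num.Theory.
Import numFieldNormedType.Exports.
Local Open Scope ring_scope.
Local Delimit Scope Z_scope with BZ.

(** Put w = 2 + sqrt 2.  A functional is dual to [Lambda s] exactly when its
    differences on p_1, ..., p_4 are integers, so it is determined by four
    integers modulo a common constant.

    For s = 0, four times such a functional has integer coordinates of equal
    parity, and a short case analysis on them finds an edge of [Delta] of length
    at least w ([wide_edge]); hence the width at s = 0 is at least w.

    For s <> 0 the width must be shown to be below w.  Consider the six
    functionals that, up to a constant, take the value 1 on one of the sets
    {p_2, p_3, p_4}, {p_2}, {p_3}, {p_4}, {p_2, p_3}, {p_3, p_4} and 0 on the
    remaining points.  At s = 0 each of them has
    width w, reached along one edge of [Delta] only, and the six edges so obtained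
    are distinct.  For small s the extreme vertices of each functional do not
    change, so it suffices to shorten one of these edges: by Cramer's rule the
    edge of the k-th functional is shorter than w if and only if the cubic
    polynomial

        G_k(s) = w D(s) - N_k(s)

    is positive, where D is the determinant of the p_i(s) - p_1(s) and N_k / D is
    the length of the edge ([gap]).

    The G_k vanish at 0.  Their linear parts L_k span a space of dimension five
    and satisfy one relation sum_k lambda_k L_k = 0, with lambda_k = sqrt 2 for
    the two functionals given by pairs and lambda_k = 1 for the other four.
    Thus first-order considerations leave a three-dimensional common kernel of the
    L_k, but on it the quadratic part of sum_k lambda_k G_k is positive definite.
    Adding a multiple of L_k to the weight of G_k adds a multiple of sum_k L_k^2,
    which makes the quadratic part definite in all directions; with
    V = s_1^(v) + s_2^(v) + s_3^(v) + s_4^(v), the combination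

        sum_k (lambda_k (1 + V) + c_k L_k) G_k

    is positive on the whole punctured box |s_i| <= 1/38, which contains the given
    one, and its weights are nonnegative there.  So some G_k(s) is positive
    ([some_gap_gt0]).  The factor 1 + V does not affect the quadratic part, because
    sum_k lambda_k L_k = 0; it reduces the cubic terms.

    All the polynomial facts are checked by computation with polynomials over
    Z[sqrt 2]: a lower bound is read off from the coefficients once an explicit
    sum of squares has been subtracted ([positive_definiteP], [const_boundP]). *)

Set Implicit Arguments.
Unset Strict Implicit.
Unset Printing Implicit Defensive.

(** * Widths of convex hulls *)

Section Widths.
Local Open Scope classical_set_scope.
Variables (R : realType) (E : lmodType R).
Implicit Types (f : {scalar E}) (L : set E).

Lemma conv_hull_bounds n (a : 'I_n -> E) f (lo hi : R) :
  (forall k, lo <= f (a k) <= hi) ->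
  forall x, conv_hull a x -> lo <= f x <= hi.
Proof.
move=> fa _ [c [c0 c1 ->]]; rewrite linear_sum.
under eq_bigr do rewrite linearZ /=.
rewrite -[lo]mul1r -[hi]mul1r -c1 !mulr_suml.
by apply/andP; split; apply: ler_sum => k _;
  apply: ler_wpM2l => //; case/andP: (fa k).
Qed.

Lemma vertex_conv_hull n (a : 'I_n -> E) k : conv_hull a (a k).
Proof.
exists (fun j => (j == k)%:R); split=> [j||].
- by rewrite ler0n.
- by rewrite (bigD1 k) //= eqxx big1 ?addr0 // => j /negPf ->.
- rewrite (bigD1 k) //= eqxx scale1r big1 ?addr0 // => j /negPf ->.
  by rewrite scale0r.
Qed.

Lemma width_le n (a : 'I_n -> E) f i j :
  (forall k, f (a j) <= f (a k) <= f (a i)) ->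
  width (conv_hull a) f <= f (a i) - f (a j).
Proof.
move=> fa; have := conv_hull_bounds fa => fK.
have ne : f @` conv_hull a !=set0.
  by exists (f (a i)), (a i) => //; exact: vertex_conv_hull.
by apply: lerB; [apply: ge_sup|apply: lb_le_inf] => // _ [x /fK/andP[? ?] <-].
Qed.

Lemma edge_le_width n (a : 'I_n -> E) f i j :
  f (a i) - f (a j) <= width (conv_hull a) f.
Proof.
have fa k : - (\sum_l `|f (a l)|) <= f (a k) <= \sum_l `|f (a l)|.
  by rewrite -ler_norml (bigD1 k) //= lerDl sumr_ge0.
have fK := conv_hull_bounds fa.
apply: lerB; [apply: ub_le_sup|apply: ge_inf].
- by exists (\sum_l `|f (a l)|) => _ [x /fK/andP[_ ?] <-].
- by exists (a i) => //; exact: vertex_conv_hull.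
- by exists (- \sum_l `|f (a l)|) => _ [x /fK/andP[? _] <-].
- by exists (a j) => //; exact: vertex_conv_hull.
Qed.

Lemma dual_affine_lattice n (p : 'I_n -> E) f c :
  (forall i, f (p i) - c \is a Num.int) -> dual_lattice (affine_lattice p) f.
Proof.
move=> fp.
have fL x : affine_lattice p x -> f x - c \is a Num.int.
  move=> [z [z1 ->]]; rewrite linear_sum -[c]mulr1z -z1 mulrz_sumr -sumrB.
  by apply: rpred_sum => i _; rewrite raddfMz -mulrzBl -mulrzr rpredM ?fp ?intr_int.
move=> _ [x Lx [y Ly <-]].
have -> : f (x - y) = f x - c - (f y - c) by rewrite raddfB opprB addrA subrK.
by rewrite rpredB ?fL.
Qed.

Lemma affine_lattice_dualB n (p : 'I_n -> E) f i j :
  dual_lattice (affine_lattice p) f -> f (p i) - f (p j) \is a Num.int.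
Proof.
have Lp k : affine_lattice p (p k).
  exists (fun l => (l == k)%:R); split.
  - by rewrite (bigD1 k) //= eqxx big1 ?addr0 // => l /negPf ->.
  - by rewrite (bigD1 k) //= eqxx mulr1z big1 ?addr0 // => l /negPf ->; rewrite mulr0z.
by move=> fL; rewrite -raddfB; apply: fL; exists (p i) => //; exists (p j).
Qed.

Lemma lattice_width_le n (a : 'I_n.+1 -> E) L f :
  dual_lattice L f -> (f : E -> R) <> (fun=> 0) ->
  lattice_width L (conv_hull a) <= width (conv_hull a) f.
Proof.
move=> fL f0; apply: ge_inf; last by exists f.
exists 0 => _ [g _ <-].
by rewrite -(subrr (g (a ord0))) edge_le_width.
Qed.

(** A nonzero dual functional is required here because the infimum of the empty
    set is 0. *)
Lemma lattice_width_ge L (K : set E) w :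
  dual_widths L K !=set0 ->
  (forall f, dual_lattice L f -> (f : E -> R) <> (fun=> 0) -> w <= width K f) ->
  w <= lattice_width L K.
Proof. by move=> ne wL; apply: lb_le_inf => // _ [f [fL f0] <-]; exact: wL. Qed.

End Widths.

(** * Width for the unperturbed lattice *)

Section Unperturbed.
Variable R : realType.
Local Notation sqrt2 := (Num.sqrt 2 : R).
Local Notation w := (2 + sqrt2).

Lemma scalar_vec3 (f : {scalar 'rV[R]_3}) a b c :
  f (vec3 a b c) = f (vec3 1 0 0) * a + f (vec3 0 1 0) * b + f (vec3 0 0 1) * c.
Proof.
have -> : vec3 a b c = a *: vec3 1 0 0 + b *: vec3 0 1 0 + c *: vec3 0 0 1.
  by apply/rowP => -[k k3]; do 3![case: k k3 => [|k] k3; first by rewrite !mxE /=; ring].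
by rewrite !linearD !linearZ /=; ring.
Qed.

(** Let (a, b, c) / 4 be the vector of f.  The edges a_1 a_3 and a_2 a_4 have lengths
    |w a + sqrt 2 b| / 2 and |w b - sqrt 2 a| / 2; one of them suffices unless |a| and
    |b| are at most 1.  In the remaining cases an edge that joins the pairs
    {a_1, a_3} and {a_2, a_4} does, chosen according to the signs of a, b and c.
    The last hypothesis selects one of f and - f. *)
Lemma wide_edge_pos (a b c m n : int) (f : {scalar 'rV[R]_3}) :
  4 * f (vec3 1 0 0) = a%:~R -> 4 * f (vec3 0 1 0) = b%:~R ->
  4 * f (vec3 0 0 1) = c%:~R -> a + b = 2 * m -> b + c = 2 * n ->
  0 < b \/ b = 0 /\ (0 < a \/ a = 0 /\ 0 < c) ->
  exists i j : 'I_4, w <= f (a_vertex R i) - f (a_vertex R j).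
Proof.
move=> ha hb hc hm hn pos.
have r2 : sqrt2 * sqrt2 = 2 by rewrite -expr2 sqr_sqrtr.
have r0 : 0 <= sqrt2 by exact: sqrtr_ge0.
have r1 : 1 <= sqrt2 by nra.
have vertexE : (f (a_vertex R (inord 0)) =
     (w * a%:~R + sqrt2 * b%:~R + w * c%:~R) / 4)
  * (f (a_vertex R (inord 1)) = (- sqrt2 * a%:~R + w * b%:~R - w * c%:~R) / 4)
  * (f (a_vertex R (inord 2)) = (- w * a%:~R - sqrt2 * b%:~R + w * c%:~R) / 4)
  * (f (a_vertex R (inord 3)) = (sqrt2 * a%:~R - w * b%:~R - w * c%:~R) / 4).
  by do !split; rewrite /a_vertex inordK //= scalar_vec3 -ha -hb -hc; lra.
have ge (k : nat) (z : int) : k%:Z <= z -> k%:R <= z%:~R :> R.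
  by move=> kz; rewrite -[k%:R]/(k%:Z%:~R) ler_int.
have le (k : nat) (z : int) : z <= - k%:Z -> z%:~R <= - k%:R :> R.
  by move=> kz; rewrite -[k%:R]/(k%:Z%:~R) -mulrNz ler_int.
have [a2|a2] := leP 2 a.
  have b0 : 0 <= b by lia.
  exists (inord 0), (inord 2); rewrite !vertexE.
  by move: (ge 2 _ a2) (ge 0 _ b0); move: (a%:~R) (b%:~R) (c%:~R) => A B C; nra.
have [b2|b2] := leP 2 b.
  have [a0|a0] := leP a 0.
    exists (inord 1), (inord 3); rewrite !vertexE.
    by move: (ge 2 _ b2) (le 0 _ a0); move: (a%:~R) (b%:~R) (c%:~R) => A B C; nra.
  have [a1 b3] : a = 1 /\ 3 <= b by lia.
  exists (inord 0), (inord 2); rewrite !vertexE a1.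
  by move: (ge 3 _ b3); move: (b%:~R) (c%:~R) => B C; nra.
have [b1|b0] : b = 1 \/ b = 0 by lia.
  have [a3|[a1|a1]] : a <= -3 \/ a = 1 \/ a = -1 by lia.
  - exists (inord 1), (inord 3); rewrite !vertexE b1.
    by move: (le 3 _ a3); move: (a%:~R) (c%:~R) => A C; nra.
  - have [c1|c1] : 1 <= c \/ c <= -1 by lia.
    + exists (inord 0), (inord 3); rewrite !vertexE b1 a1.
      by move: (ge 1 _ c1); move: (c%:~R) => C; nra.
    + exists (inord 1), (inord 2); rewrite !vertexE b1 a1.
      by move: (le 1 _ c1); move: (c%:~R) => C; nra.
  - have [c1|c1] : 1 <= c \/ c <= -1 by lia.
    + exists (inord 2), (inord 3); rewrite !vertexE b1 a1.
      by move: (ge 1 _ c1); move: (c%:~R) => C; nra.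
    + exists (inord 1), (inord 0); rewrite !vertexE b1 a1.
      by move: (le 1 _ c1); move: (c%:~R) => C; nra.
have [a0 c2] : a = 0 /\ 2 <= c by lia.
exists (inord 0), (inord 1); rewrite !vertexE a0 b0.
by move: (ge 2 _ c2); move: (c%:~R) => C; nra.
Qed.

Lemma wide_edge (f : {scalar 'rV[R]_3}) :
  dual_lattice (Lambda 0) f -> (f : _ -> R) <> (fun=> 0) ->
  exists i j : 'I_4, w <= f (a_vertex R i) - f (a_vertex R j).
Proof.
move=> fL f0.
have p0 (i : 'I_4) : p_point (t_of_s (0 : 'rV[R]_8)) i =
    nth 0 [:: vec3 (-1) (-1) (-1); vec3 1 (-1) 1; vec3 1 1 (-1); vec3 (-1) 1 1] i.
  rewrite /t_of_s mul0mx /p_point; case: i => i i4 /=.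
  by do 4![case: i i4 => [|i] i4; first by
    apply/rowP => -[k k3]; do 3![case: k k3 => [|k] k3; first by rewrite !mxE /=; ring]].
have fp := affine_lattice_dualB _ _ fL.
have /intrP[m hm] := fp (inord 1) (inord 0).
have /intrP[n hn] := fp (inord 2) (inord 0).
have /intrP[q hq] := fp (inord 3) (inord 0).
rewrite !p0 !inordK //= (scalar_vec3 f (-1) (-1) (-1)) in hm hn hq.
rewrite (scalar_vec3 f 1 (-1) 1) in hm.
rewrite (scalar_vec3 f 1 1 (-1)) in hn.
rewrite (scalar_vec3 f (-1) 1 1) in hq.
have ha : 4 * f (vec3 1 0 0) = (m + n - q)%:~R.
  by rewrite intrB intrD -hm -hn -hq; ring.
have hb : 4 * f (vec3 0 1 0) = (n + q - m)%:~R.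
  by rewrite intrB intrD -hm -hn -hq; ring.
have hc : 4 * f (vec3 0 0 1) = (m + q - n)%:~R.
  by rewrite intrB intrD -hm -hn -hq; ring.
move: ha hb hc; set a := m + n - q; set b := n + q - m; set c := m + q - n.
move=> ha hb hc.
have hab : a + b = 2 * n by rewrite /a /b; ring.
have hbc : b + c = 2 * q by rewrite /b /c; ring.
have [pos|[neg|[a0 [b0 c0]]]] :
    (0 < b \/ b = 0 /\ (0 < a \/ a = 0 /\ 0 < c)) \/
    (0 < - b \/ - b = 0 /\ (0 < - a \/ - a = 0 /\ 0 < - c)) \/
    a = 0 /\ b = 0 /\ c = 0 by lia.
- exact: wide_edge_pos ha hb hc hab hbc pos.
- pose g : {scalar 'rV[R]_3} := [the {scalar 'rV[R]_3} of \- f].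
  have [] := @wide_edge_pos (- a) (- b) (- c) (- n) (- q) g _ _ _ _ _ neg.
  + by rewrite /g /= mulrN ha intrN.
  + by rewrite /g /= mulrN hb intrN.
  + by rewrite /g /= mulrN hc intrN.
  + by lia.
  + by lia.
  by move=> i [j ij]; exists j, i; apply: le_trans ij _; rewrite /g /=; lra.
- case: f0; apply/funext => u.
  have -> : u = vec3 (u 0 0) (u 0 1) (u 0 2).
    by apply/rowP => -[k k3]; do 3![case: k k3 => [|k] k3; first by
      rewrite !mxE /=; congr (u _ _); exact: val_inj].
  by rewrite scalar_vec3; move: ha hb hc; rewrite a0 b0 c0; nra.
Qed.

End Unperturbed.

(** * Certified lower bounds for polynomials over Z[sqrt 2] *)

(** The pair (a, b) stands for a + b sqrt 2. *)
Definition coef := (Z * Z)%type.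
(** A monomial is the sorted list of its variables, with repetitions. *)
Definition zpoly := seq (seq nat * coef).

Definition cadd (c d : coef) : coef := ((c.1 + d.1)%BZ, (c.2 + d.2)%BZ).
Definition cmul (c d : coef) : coef :=
  ((c.1 * d.1 + 2 * (c.2 * d.2))%BZ, (c.1 * d.2 + c.2 * d.1)%BZ).

Fixpoint pinsert (t : seq nat * coef) (p : zpoly) : zpoly :=
  if p is u :: q then
    if u.1 == t.1 then (u.1, cadd u.2 t.2) :: q else u :: pinsert t q
  else [:: t].

Definition padd (p q : zpoly) : zpoly := foldr pinsert q p.
Definition tmul (t u : seq nat * coef) : seq nat * coef :=
  (merge leq t.1 u.1, cmul t.2 u.2).
Definition pmul (p q : zpoly) : zpoly :=
  foldr (fun t => padd [seq tmul t u | u <- q]) [::] p.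
Definition pconst (c : coef) : zpoly := [:: ([::], c)].
Definition psub (p q : zpoly) : zpoly := padd p (pmul (pconst (-1, 0)%BZ) q).
Definition linear_form (cs : seq coef) : zpoly :=
  [seq ([:: i], nth (0, 0)%BZ cs i) | i <- iota 0 (size cs)].

(** Bounds of 60 (a + b sqrt 2) from 84 < 60 sqrt 2 < 85: an upper bound for
    [true] and a lower bound for [false]. *)
Definition cbound (b : bool) (c : coef) : Z :=
  (60 * c.1 + (if (0 <=? c.2)%BZ == b then 85 else 84) * c.2)%BZ.
Definition clower := cbound false.
Definition cabs (c : coef) : Z := Z.max (cbound true c) (- clower c).

(** A lower bound of 60 p on the box |x_i| <= 1: every nonconstant monomial is
    estimated by 1. *)
Definition const_bound (p : zpoly) : Z :=
  foldr (fun t b => if t.1 is [::] then clower t.2 + b else b - cabs t.2)%BZ 0%BZ p.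

(** On the box |x_i| <= 1 a monomial that contains x_j and x_k is at least
    - (x_j ^ 2 + x_k ^ 2) / 2.  Applied to the first two variables of the term t,
    this gives a diagonal quadratic form below 120 t; here is its coefficient at
    x_i ^ 2.  Pure squares are kept exactly. *)
Definition square_weight (i : nat) (t : seq nat * coef) : Z :=
  match t.1 with
  | j :: k :: m =>
    if (j == k) && nilp m then if i == j then 2 * clower t.2 else 0
    else ((if i == j then - cabs t.2 else 0) + (if i == k then - cabs t.2 else 0))
  | _ => 0
  end%BZ.
Definition square_bound (i : nat) (p : zpoly) : Z :=
  foldr (fun t b => square_weight i t + b)%BZ 0%BZ p.
(** Addition keeps the monomials whose coefficients cancel. *)
Definition no_low_degree (t : seq nat * coef) : bool :=
  (1 < size t.1)%N || (t.2 == (0, 0)%BZ).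
Definition positive_definite (n : nat) (p : zpoly) : bool :=
  [&& all no_low_degree p, all (fun t => all (fun i => i < n)%N t.1) p
    & all (fun i => (0 <? square_bound i p)%BZ) (iota 0 n)].

Definition pzero (p : zpoly) : bool := all (fun t => t.2 == (0, 0)%BZ) p.

Section Evaluation.
Local Arguments Z.add : simpl never.
Local Arguments Z.mul : simpl never.
Local Arguments Z.opp : simpl never.
Local Arguments Z.sub : simpl never.
Variables (R : realType) (x : nat -> R).
Local Notation sqrt2 := (Num.sqrt 2 : R).

Definition zval (z : Z) : R := (int_of_Z z)%:~R.
Definition cval (c : coef) : R := zval c.1 + zval c.2 * sqrt2.
Definition mval (m : seq nat) : R := \prod_(i <- m) x i.
Definition pval (p : zpoly) : R := \sum_(t <- p) cval t.2 * mval t.1.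

Lemma zvalD a b : zval (a + b)%BZ = zval a + zval b.
Proof. by rewrite /zval (rmorphD int_of_Z a b) intrD. Qed.

Lemma zvalN a : zval (- a)%BZ = - zval a.
Proof. by rewrite /zval (rmorphN int_of_Z a) intrN. Qed.

Lemma zvalM a b : zval (a * b)%BZ = zval a * zval b.
Proof. by rewrite /zval (rmorphM int_of_Z a b) intrM. Qed.

Lemma zval_nat n : zval (Z.of_nat n) = n%:R.
Proof. by rewrite /zval (_ : int_of_Z _ = n) //; lia. Qed.

Lemma zval_ge0 a : (0 <= a)%BZ -> 0 <= zval a.
Proof. by move=> a0; rewrite /zval ler0z; lia. Qed.

Lemma zval_gt0 a : (0 < a)%BZ -> 0 < zval a.
Proof. by move=> a0; rewrite /zval ltr0z; lia. Qed.

Lemma ler_zval a b : (a <= b)%BZ -> zval a <= zval b.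
Proof. by move=> ab; rewrite /zval ler_int; lia. Qed.

Let sqrt2_sqr : sqrt2 * sqrt2 = 2.
Proof. by rewrite -expr2 sqr_sqrtr. Qed.

Lemma sqrt2_bounds : 84 < 60 * sqrt2 < 85.
Proof.
have := sqrt2_sqr; have : 0 <= sqrt2 by exact: sqrtr_ge0.
by move: sqrt2 => r r0 r2; apply/andP; split; nra.
Qed.

Lemma cvalD c d : cval (cadd c d) = cval c + cval d.
Proof. by rewrite /cval !zvalD; ring. Qed.

Lemma cvalM c d : cval (cmul c d) = cval c * cval d.
Proof.
rewrite /cval /cmul !(zvalD, zvalM).
have -> : zval 2 = sqrt2 * sqrt2 by rewrite sqrt2_sqr (zval_nat 2).
ring.
Qed.

Lemma pval_cons t p : pval (t :: p) = cval t.2 * mval t.1 + pval p.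
Proof. by rewrite /pval big_cons. Qed.

Lemma pval_insert t p : pval (pinsert t p) = cval t.2 * mval t.1 + pval p.
Proof.
elim: p => [|u p IHp] /=; first by rewrite pval_cons.
case: eqP => [tu|_]; rewrite !pval_cons /= ?IHp ?cvalD ?tu; ring.
Qed.

Lemma pvalD p q : pval (padd p q) = pval p + pval q.
Proof.
elim: p => [|t p IHp] /=; first by rewrite /pval big_nil add0r.
by rewrite pval_insert IHp pval_cons addrA.
Qed.

Lemma pvalM p q : pval (pmul p q) = pval p * pval q.
Proof.
elim: p => [|t p IHp] /=; first by rewrite /pval !big_nil mul0r.
rewrite pvalD IHp pval_cons mulrDl; congr (_ + _).
rewrite /pval big_map mulr_sumr; apply: eq_bigr => u _ /=.
by rewrite cvalM /mval (perm_big _ (permEl (perm_merge _ _ _))) big_cat /= mulrACA.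
Qed.

Lemma pval_const c : pval (pconst c) = cval c.
Proof. by rewrite /pval big_seq1 /mval big_nil mulr1. Qed.

Lemma pvalB p q : pval (psub p q) = pval p - pval q.
Proof. by rewrite pvalD pvalM pval_const /cval mul0r addr0 mulN1r. Qed.

Lemma pval_zero p : pzero p -> pval p = 0.
Proof.
move=> /allP p0; rewrite /pval big_seq big1 // => t /p0 /eqP ->.
by rewrite /cval mul0r addr0 mul0r.
Qed.

Lemma cboundP c : zval (clower c) <= 60 * cval c <= zval (cbound true c).
Proof.
have /andP[r1 r2] := sqrt2_bounds.
rewrite /clower /cbound /cval !(zvalD, zvalM).
have -> : zval 60 = 60 by exact: (zval_nat 60).
have e0 : zval 84 = 84 by exact: (zval_nat 84).
have e1 : zval 85 = 85 by exact: (zval_nat 85).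
case: Z.leb_spec => c0 /=; rewrite e0 e1.
  by have {}c0 := zval_ge0 c0; apply/andP; split; nra.
have {}c0 : zval c.2 <= 0 by rewrite -oppr_ge0 -zvalN zval_ge0 //; lia.
by apply/andP; split; nra.
Qed.

Lemma cabsP c : `|60 * cval c| <= zval (cabs c).
Proof.
have /andP[c1 c2] := cboundP c; rewrite ler_norml; apply/andP; split.
  apply: le_trans c1; rewrite lerNl -zvalN ler_zval // /cabs; lia.
by apply: le_trans c2 _; rewrite ler_zval // /cabs; lia.
Qed.

Hypothesis x_le1 : forall i, `|x i| <= 1.

Lemma mval_le1 m : `|mval m| <= 1.
Proof.
elim: m => [|i m IHm]; rewrite /mval ?big_nil ?normr1 // big_cons normrM.
by rewrite mulr_ile1.
Qed.

Lemma const_boundP p : zval (const_bound p) <= 60 * pval p.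
Proof.
elim: p => [|[m c] p IHp] /=; first by rewrite /pval big_nil mulr0.
rewrite pval_cons mulrDr /=; case: m => [|i m].
  rewrite zvalD lerD // /mval big_nil mulr1.
  by have /andP[] := cboundP c.
rewrite zvalD addrC lerD // zvalN mulrA lerNl.
apply: le_trans (cabsP c); rewrite -normrN -mulNr.
apply: le_trans (ler_norm _) _; rewrite normrM ler_piMr //.
exact: mval_le1.
Qed.

Lemma pval_gt0 p : (0 <? const_bound p)%BZ -> 0 < pval p.
Proof.
move=> /Z.ltb_spec0 /zval_gt0 p0.
by rewrite -(@pmulr_rgt0 _ 60) // (lt_le_trans p0) // const_boundP.
Qed.

Lemma pval_ge0 p : (0 <=? const_bound p)%BZ -> 0 <= pval p.
Proof.
move=> /Z.leb_spec0 /zval_ge0 p0.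
have c_gt0 : 0 < 60 :> R by [].
by rewrite -(pmulr_rge0 _ c_gt0); apply: (le_trans p0); exact: const_boundP.
Qed.

Lemma square_weightP n t :
  no_low_degree t -> all (fun i => i < n)%N t.1 ->
  \sum_(i < n) zval (square_weight i t) * x i ^+ 2
    <= 2 * 60 * (cval t.2 * mval t.1).
Proof.
have pick (j : 'I_n) z :
    \sum_(i < n) zval (if val i == j then z else 0) * x i ^+ 2 = zval z * x j ^+ 2.
  rewrite (bigD1 j) //= eqxx big1 ?addr0 // => i /negPf ij.
  by rewrite (inj_eq val_inj) ij mul0r.
case: t => m c; rewrite /no_low_degree /square_weight /=.
case: m => [|j [|k m]] /=.
- by move=> /eqP -> _; rewrite /cval big1 ?mul0r ?addr0 ?mul0r ?mulr0 // => i _; rewrite mul0r.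
- by move=> /eqP -> _; rewrite /cval big1 ?mul0r ?addr0 ?mul0r ?mulr0 // => i _; rewrite mul0r.
move=> _ /and3P[jn kn _]; rewrite /mval !big_cons.
have [/andP[/eqP <- /nilP ->]|_] := boolP ((j == k) && nilp m).
  rewrite /= (pick (Ordinal jn)) big_nil zvalM /=.
  have -> : zval 2 = 2 by exact: (zval_nat 2).
  have -> : 2 * 60 * (cval c * (x j * (x j * 1)))
    = 2 * (60 * cval c) * x j ^+ 2 by ring.
  rewrite ler_wpM2r ?sqr_ge0 // ler_pM2l //.
  by have /andP[] := cboundP c.
under eq_bigr do rewrite zvalD mulrDl.
rewrite big_split /= (pick (Ordinal jn)) (pick (Ordinal kn)) /= !zvalN.
have := cabsP c; have := mval_le1 m; rewrite /mval.
move: (\prod_(i <- m) x i) (zval (cabs c)) (cval c) (x j) (x k) => y b d u v.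
set e := 60 * d => y1 eb.
have /ler_normlP[] : `|e * y| <= b.
  by rewrite normrM; apply: le_trans eb; rewrite ler_piMr.
have -> : 2 * 60 * (d * (u * (v * y))) = 2 * (e * y) * (u * v) by rewrite /e; ring.
move: (e * y) => z z1 z2.
(* b (u ^ 2 + v ^ 2) + 2 z u v is the half sum of the next two products. *)
have z3 : 0 <= (b + z) * (u + v) ^+ 2 by rewrite mulr_ge0 ?sqr_ge0 //; lra.
have z4 : 0 <= (b - z) * (u - v) ^+ 2 by rewrite mulr_ge0 ?sqr_ge0 //; lra.
lra.
Qed.

Lemma positive_definiteP n p : positive_definite n p ->
  (exists2 i, (i < n)%N & x i != 0) -> 0 < pval p.
Proof.
move=> /and3P[/allP low /allP small /allP weight] [i0 i0n xi0].
have le : \sum_(i < n) zval (square_bound i p) * x i ^+ 2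
    <= 2 * 60 * pval p.
  elim: p low small {weight} => [|t p IHp] low small /=.
    by rewrite /pval big_nil mulr0 big1 // => i _; rewrite mul0r.
  under eq_bigr do rewrite zvalD mulrDl.
  rewrite big_split pval_cons mulrDr lerD //=.
    by apply: square_weightP; [apply: low|apply: small]; rewrite mem_head.
  by apply: IHp => u pu; [apply: low|apply: small]; rewrite in_cons pu orbT.
have w0 (i : 'I_n) : 0 < zval (square_bound i p).
  by apply/zval_gt0/Z.ltb_spec0/weight; rewrite mem_iota ltn_ord.
have c_gt0 : 0 < 2 * 60 :> R by rewrite mulr_gt0.
rewrite -(pmulr_rgt0 _ c_gt0); apply: (lt_le_trans _ le).
rewrite (bigD1 (Ordinal i0n)) //=; apply: ltr_pwDl.
  by rewrite (mulr_gt0 (w0 (Ordinal i0n))) // exprn_even_gt0.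
by apply: sumr_ge0 => i _; rewrite mulr_ge0 ?sqr_ge0 // ltW.
Qed.

End Evaluation.

(** * The perturbed lattice as a family of polynomials *)

Definition cvec := (coef * coef * coef)%type.
Definition pvec := (zpoly * zpoly * zpoly)%type.
Definition copp (c : coef) : coef := ((- c.1)%BZ, (- c.2)%BZ).
(** The isometry (x, y, z) |-> (-y, x, -z).  It permutes the vertices of [Delta]
    cyclically, and likewise the points p_i together with their two directions of
    motion, which is what the coordinates s^(h) and s^(v) are designed for. *)
Definition quarter_turn (u : cvec) : cvec := (copp u.1.2, u.1.1, copp u.2).
Definition vertex i : cvec := iter i quarter_turn ((2, 1), (0, 1), (2, 1))%BZ.
Definition base_point i : cvec := iter i quarter_turn ((-1, 0), (-1, 0), (-1, 0))%BZ.
Definition h_dir i : cvec := iter i quarter_turn ((0, 1), (-2, -1), (0, 0))%BZ.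
Definition v_dir i : cvec := iter i quarter_turn ((-2, -1), (0, -1), (4, 2))%BZ.

Definition pvar i : zpoly := [:: ([:: i], (1, 0)%BZ)].
Definition cvec_poly (u : cvec) : pvec := (pconst u.1.1, pconst u.1.2, pconst u.2).
Definition vadd (u v : pvec) : pvec := (padd u.1.1 v.1.1, padd u.1.2 v.1.2, padd u.2 v.2).
Definition vscale (p : zpoly) (u : pvec) : pvec := (pmul p u.1.1, pmul p u.1.2, pmul p u.2).
Definition vsub (u v : pvec) : pvec := vadd u (vscale (pconst (-1, 0)%BZ) v).
Definition vdot (u v : pvec) : zpoly :=
  padd (padd (pmul u.1.1 v.1.1) (pmul u.1.2 v.1.2)) (pmul u.2 v.2).
Definition vcross (u v : pvec) : pvec :=
  (psub (pmul u.1.2 v.2) (pmul u.2 v.1.2),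
   psub (pmul u.2 v.1.1) (pmul u.1.1 v.2),
   psub (pmul u.1.1 v.1.2) (pmul u.1.2 v.1.1)).

(** The point p_(i+1), scaled by 38.  The variables 2i and 2i+1 stand for
    38 s_(i+1)^(h) and 38 s_(i+1)^(v), so that they range over [-1, 1] and all the
    coefficients stay in Z[sqrt 2]. *)
Definition point i : pvec :=
  vadd (vscale (pconst (38, 0)%BZ) (cvec_poly (base_point i)))
    (vadd (vscale (pvar i.*2) (cvec_poly (h_dir i)))
          (vscale (pvar i.*2.+1) (cvec_poly (v_dir i)))).
Definition step i : pvec := vsub (point i) (point 0).
Definition det : zpoly := vdot (step 1) (vcross (step 2) (step 3)).

(** A functional dual to the lattice, given by its values on the p_i up to a
    constant, with the end points of the edge of [Delta] that computes its width.
    The last two fields are lambda_k and 24 c_k. *)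
Record critical := Critical
  { values : seq Z; top : nat; bottom : nat; weight : coef; penalty : Z }.

(** Here c_k is 1 / 8 or 1 / 6: large enough to make the quadratic part of the
    combination definite, and small enough to keep the cubic terms and the
    variation of the weights under control. *)
Definition criticals : seq critical := [::
  Critical [:: 0; 1; 1; 0]%BZ 0 2 (0, 1)%BZ 3;
  Critical [:: 0; 0; 1; 1]%BZ 1 3 (0, 1)%BZ 3;
  Critical [:: 0; 1; 1; 1]%BZ 0 3 (1, 0)%BZ 4;
  Critical [:: 0; 1; 0; 0]%BZ 0 1 (1, 0)%BZ 4;
  Critical [:: 0; 0; 1; 0]%BZ 1 2 (1, 0)%BZ 4;
  Critical [:: 0; 0; 0; 1]%BZ 2 3 (1, 0)%BZ 4 ].

Definition value_const k i : zpoly := pconst (nth 0%BZ (values k) i, 0%BZ).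
(** Cramer's rule: [numerator k] divided by [det] is the vector of the functional
    that takes the prescribed values on the three [step]s. *)
Definition numerator (k : critical) : pvec :=
  vadd (vscale (value_const k 1) (vcross (step 2) (step 3)))
    (vadd (vscale (value_const k 2) (vcross (step 3) (step 1)))
          (vscale (value_const k 3) (vcross (step 1) (step 2)))).
(** The difference of the k-th functional between two vertices of [Delta],
    multiplied by [det] / 38. *)
Definition rise (k : critical) i j : zpoly :=
  vdot (numerator k) (vsub (cvec_poly (vertex i)) (cvec_poly (vertex j))).
Definition gap (k : critical) : zpoly :=
  psub (pmul (pconst (2, 1)%BZ) det)
       (pmul (pconst (38, 0)%BZ) (rise k (top k) (bottom k))).
Definition linear_part (p : zpoly) : zpoly := [seq t <- p | size t.1 == 1].

(** The weight lambda_k (1 + V) + c_k L_k of G_k, scaled by 24 * 38 ^ 3; the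
    scaling of the variables turns the linear part of [gap] into 38 ^ 3 L_k. *)
Definition multiplier (k : critical) : zpoly :=
  padd (pmul (pconst (penalty k, 0)%BZ) (linear_part (gap k)))
    (pmul (pmul (pconst (24 * 38 * 38, 0)%BZ) (pconst (weight k)))
       (padd (pconst (38, 0)%BZ)
          (padd (padd (pvar 1) (pvar 3)) (padd (pvar 5) (pvar 7))))).

(** The quadratic part of the combination is invariant under the cyclic shift of
    the indices that [quarter_turn] induces, so it splits along the eigenspaces of
    that shift.  These linear forms belong to the eigenvalues 1 (first two),
    -1 (third) and i, -i (last four).
    All but the second absorb the coupling between the h and v coordinates, and
    the second absorbs the coupling of the v coordinates with each other; what
    remains is dominated by its diagonal. *)
Definition squares : seq (nat * seq Z) := [::
  (1, [:: 1; -2; 1; -2; 1; -2; 1; -2]%BZ);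
  (8, [:: 0; 1; 0; 1; 0; 1; 0; 1]%BZ);
  (3, [:: 1; -1; -1; 1; 1; -1; -1; 1]%BZ);
  (5, [:: 1; 0; 0; -1; -1; 0; 0; 1]%BZ);
  (5, [:: 0; 1; 1; 0; 0; -1; -1; 0]%BZ);
  (2, [:: 1; 1; 0; 0; -1; -1; 0; 0]%BZ);
  (2, [:: 0; 0; 1; 1; 0; 0; -1; -1]%BZ) ]%N.
(** The combination is scaled by 24 * 38 ^ 6 and the square of a variable by 38 ^ 2:
   in the coordinates s the coefficients of the squares are 20, 160, 60, and so on. *)
Definition sum_squares (qs : seq (nat * seq Z)) : zpoly :=
  foldr (fun q => let l := linear_form [seq (a, 0%BZ) | a <- q.2] in
    padd (pmul (pconst (20 * 24 * 38 * 38 * 38 * 38 * Z.of_nat q.1, 0)%BZ) (pmul l l)))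
    [::] qs.
Definition combination (ks : seq critical) : zpoly :=
  foldr (fun k => padd (pmul (multiplier k) (gap k))) [::] ks.

Section Forms.
Variable R : realType.

Definition dot_form (u y : 'rV[R]_3) : R := (y *m u^T) 0 0.

Fact dot_form_is_scalar u : scalar (dot_form u).
Proof. by move=> c y z; rewrite /dot_form mulmxDl -scalemxAl !mxE. Qed.

HB.instance Definition _ u :=
  GRing.isLinear.Build R 'rV[R]_3 R *%R (dot_form u) (dot_form_is_scalar u).

Lemma dot_formZl c u y : dot_form (c *: u) y = c * dot_form u y.
Proof. by rewrite /dot_form linearZ /= -scalemxAr mxE. Qed.

Lemma dot_form_vec3 a b c d e f :
  dot_form (vec3 a b c) (vec3 d e f) = a * d + b * e + c * f.
Proof. by rewrite /dot_form mxE !big_ord_recr big_ord0 /= !mxE /=; ring. Qed.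

End Forms.

Section Realization.
Variables (R : realType) (s : 'rV[R]_8).
Local Notation sqrt2 := (Num.sqrt 2 : R).
Local Notation w := (2 + sqrt2).
Local Notation S k := (s 0 (inord k)).

Let sqrt2_mul (a : R) : sqrt2 * (sqrt2 * a) = 2 * a.
Proof. by rewrite mulrA -expr2 sqr_sqrtr. Qed.

(** Each 2 x 2 block of the change of variables is a multiple of an orthogonal
    matrix, so it is inverted by a multiple of its transpose. *)
Lemma t_of_sE : t_of_s s = \row_(k < 8)
  [:: sqrt2 * S 0 - w * S 1; - w * S 0 - sqrt2 * S 1;
      w * S 2 + sqrt2 * S 3; sqrt2 * S 2 - w * S 3;
      - sqrt2 * S 4 + w * S 5; w * S 4 + sqrt2 * S 5;
      - w * S 6 - sqrt2 * S 7; - sqrt2 * S 6 + w * S 7]`_k.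
Proof.
(* Each identity is linear once sqrt 2 * (sqrt 2 * a) = 2 a is known for all the
   coordinates a of s. *)
set t := (X in _ = X); have <- : s_of_t t = s; last by rewrite s_of_tK.
apply/rowP => k; rewrite mxE -[k]inord_val; move: (val k) (ltn_ord k) => {}k k8.
rewrite inordK //; do 8![case: k k8 => [|k] k8; first
 by rewrite !mxE /=; move: (S 0) (S 1) (S 2) (S 3) (S 4) (S 5) (S 6) (S 7)
   => h1 v1 h2 v2 h3 v3 h4 v4;
  move: (sqrt2_mul h1) (sqrt2_mul h2) (sqrt2_mul h3) (sqrt2_mul h4)
   (sqrt2_mul v1) (sqrt2_mul v2) (sqrt2_mul v3) (sqrt2_mul v4);
  move: sqrt2 => r; lra].
by [].
Qed.

Definition coord (i : nat) : R := 38 * S i.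
Local Notation pval := (pval coord).
Definition vval (u : pvec) : 'rV[R]_3 := vec3 (pval u.1.1) (pval u.1.2) (pval u.2).

Lemma vvalD u v : vval (vadd u v) = vval u + vval v.
Proof.
by apply/rowP => -[k k3]; rewrite !mxE /= !pvalD; do 3![case: k k3 => [|k] k3 //].
Qed.

Lemma vvalZ p u : vval (vscale p u) = pval p *: vval u.
Proof.
by apply/rowP => -[k k3]; rewrite !mxE /= !pvalM; do 3![case: k k3 => [|k] k3 //].
Qed.

Lemma pval_constZ z : pval (pconst (z, 0%BZ)) = zval R z.
Proof. by rewrite pval_const /cval mul0r addr0. Qed.

Lemma vvalB u v : vval (vsub u v) = vval u - vval v.
Proof. by rewrite vvalD vvalZ pval_constZ (_ : zval R (-1)%BZ = -1) // scaleN1r. Qed.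

Lemma dot_form_vval u v : dot_form (vval u) (vval v) = pval (vdot u v).
Proof. by rewrite dot_form_vec3 /vdot !pvalD !pvalM. Qed.

Lemma pval_pvar i : pval (pvar i) = 38 * S i.
Proof. by rewrite /pval big_seq1 /mval big_seq1 /cval mul0r addr0 mul1r. Qed.

Lemma cvalN c : cval R (copp c) = - cval R c.
Proof. by rewrite /cval !zvalN; ring. Qed.

Let constants : (cval R (0, 0)%BZ = 0) * (cval R (-1, 0)%BZ = -1) *
  (cval R (0, 1)%BZ = sqrt2) * (cval R (0, -1)%BZ = - sqrt2) *
  (cval R (2, 1)%BZ = w) * (cval R (38, 0)%BZ = 38) *
  (cval R (-2, -1)%BZ = - w) * (cval R (4, 2)%BZ = 2 * w).
Proof.
rewrite /cval /= (zvalN R 1) (zvalN R 2).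
rewrite (_ : zval R 0 = 0) // (_ : zval R 1 = 1) // (_ : zval R 2 = 2) //.
rewrite (_ : zval R 4 = 4) // (_ : zval R 38 = 38) //.
by do !split; ring.
Qed.

Lemma vval_vertex (i : 'I_4) : vval (cvec_poly (vertex i)) = a_vertex R i.
Proof.
case: i => i i4; rewrite /a_vertex /=.
do 4![case: i i4 => [|i] i4; first by
  rewrite /vval /= !pval_const ?cvalN !constants; congr vec3; ring].
by [].
Qed.

Lemma vval_point (i : 'I_4) : vval (point i) = 38 *: p_point (t_of_s s) i.
Proof.
rewrite /point !vvalD !vvalZ t_of_sE pval_const constants !pval_pvar.
case: i => i i4; rewrite /p_point /=.
do 4![case: i i4 => [|i] i4; first by
  apply/rowP => -[k k3]; do 3![case: k k3 => [|k] k3; first by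
   rewrite !mxE /= !pval_const ?cvalN !constants;
   move: (S 0) (S 1) (S 2) (S 3) (S 4) (S 5) (S 6) (S 7)
   => h1 v1 h2 v2 h3 v3 h4 v4;
  move: (sqrt2_mul h1) (sqrt2_mul h2) (sqrt2_mul h3) (sqrt2_mul h4)
   (sqrt2_mul v1) (sqrt2_mul v2) (sqrt2_mul v3) (sqrt2_mul v4);
  move: sqrt2 => r; lra]].
by [].
Qed.

End Realization.

(** * The certificate *)

(* Conversion would otherwise expand the certificate polynomials. *)
Local Opaque padd pmul.
Local Arguments Z.mul : simpl never.
Definition dual_identity (k : critical) i : bool :=
  pzero (psub (vdot (numerator k) (step i)) (pmul (value_const k i) det)).
(** The extreme vertices of the functional are those of the unperturbed one. *)
Definition ordered (k : critical) i : bool :=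
  (0 <=? const_bound (rise k (top k) i))%BZ && (0 <=? const_bound (rise k i (bottom k)))%BZ.
Definition valid_critical (k : critical) : bool :=
  [&& (top k < 4)%N, (bottom k < 4)%N,
      has (fun i => nth 0%BZ (values k) i == 1%BZ) (iota 0 4),
      all (dual_identity k) (iota 0 4), all (ordered k) (iota 0 4)
    & (0 <=? const_bound (multiplier k))%BZ].

Lemma criticals_valid : all valid_critical criticals.
Proof. by vm_compute. Qed.

Lemma det_positive : (0 <? const_bound det)%BZ.
Proof. by vm_compute. Qed.

Lemma combination_positive_definite :
  positive_definite 8 (psub (combination criticals) (sum_squares squares)).
Proof. by vm_compute. Qed.

Section Perturbation.
Variables (R : realType) (s : 'rV[R]_8).
Hypotheses (s_neq0 : s <> 0) (s_le : forall i, `|s 0 i| <= 38^-1).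
Local Notation x := (coord s).
Local Notation w := (2 + Num.sqrt 2 : R).

Lemma coord_le1 i : `|x i| <= 1.
Proof.
by rewrite /coord normrM gtr0_norm // mulrC -ler_pdivlMr // mul1r s_le.
Qed.

Lemma coord_neq0 : exists2 i, (i < 8)%N & x i != 0.
Proof.
have [i si0|s0] := pickP (fun i => s 0 i != 0).
  by exists i => //; rewrite /coord inord_val mulf_neq0 // pnatr_eq0.
by case: s_neq0; apply/rowP => i; rewrite mxE; apply/eqP/negbFE/s0.
Qed.

Lemma det_gt0 : 0 < pval x det.
Proof. exact: pval_gt0 coord_le1 _ det_positive. Qed.

Definition critical_form (k : critical) : 'rV[R]_3 :=
  (38 / pval x det) *: vval s (numerator k).

Lemma pval_identity p q z : pzero (psub p (pmul (pconst (z, 0)%BZ) q)) ->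
  pval x p = zval R z * pval x q.
Proof.
by move=> /(pval_zero x); rewrite pvalB pvalM pval_constZ => /eqP; rewrite subr_eq0 => /eqP.
Qed.

Lemma pval_gap p q :
  pval x (psub (pmul (pconst (2, 1)%BZ) p) (pmul (pconst (38, 0)%BZ) q))
  = w * pval x p - 38 * pval x q.
Proof.
have e1 : cval R (2, 1)%BZ = w by rewrite /cval mul1r.
have e2 : cval R (38, 0)%BZ = 38 by rewrite /cval mul0r addr0.
by rewrite pvalB !pvalM !pval_const e1 e2.
Qed.

Lemma critical_form_point k (i : 'I_4) : valid_critical k ->
  dot_form (critical_form k) (p_point (t_of_s s) i)
  - dot_form (critical_form k) (p_point (t_of_s s) 0) = zval R (nth 0%BZ (values k) i).
Proof.
move=> /and5P[_ _ _ /allP dual _].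
have := dual i; rewrite mem_iota ltn_ord => /(_ isT) /pval_identity.
rewrite -dot_form_vval vvalB (vval_point s i) (vval_point s 0) -scalerBr.
rewrite linearZ /= => e; rewrite -raddfB /= /critical_form dot_formZl.
rewrite -mulrA mulrCA e mulrCA mulVf ?mulr1 // gt_eqF //; exact: det_gt0.
Qed.

Lemma critical_form_vertex k (i j : 'I_4) :
  dot_form (critical_form k) (a_vertex R i) - dot_form (critical_form k) (a_vertex R j)
  = 38 / pval x det * pval x (rise k i j).
Proof.
by rewrite -raddfB /= /critical_form dot_formZl -!(vval_vertex s) -vvalB dot_form_vval.
Qed.

Definition critical_functional k : {scalar 'rV[R]_3} :=
  [the {scalar 'rV[R]_3} of dot_form (critical_form k)].

Lemma critical_dual k : valid_critical k ->
  dual_lattice (Lambda s) (critical_functional k).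
Proof.
move=> kv; apply: (@dual_affine_lattice _ _ _ _ _
  (critical_functional k (p_point (t_of_s s) 0))) => i.
by rewrite critical_form_point // intr_int.
Qed.

Lemma critical_neq0 k : valid_critical k ->
  (critical_functional k : _ -> R) <> (fun=> 0).
Proof.
move=> kv; have /and5P[_ _ /hasP[i i4 /eqP vi] _ _] := kv.
rewrite mem_iota /= in i4.
move=> f0; have := critical_form_point (Ordinal i4) kv.
rewrite -/(critical_functional k _) -/(critical_functional k (p_point _ 0)) f0.
rewrite /= vi subrr => /esym/eqP.
by rewrite (_ : zval R 1 = 1) // oner_eq0.
Qed.

(** The k-th functional stays between its values at the two end points of its edge,
    so its width is the length of that edge, and [gap] compares this length with w. *)
Lemma critical_width k : valid_critical k -> 0 < pval x (gap k) ->
  lattice_width (Lambda s) (@Delta R) < w.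
Proof.
move=> kv gap_gt0; have /and5P[top4 bot4 _ _ /andP[/allP ord _]] := kv.
have d0 := det_gt0.
apply: le_lt_trans (lattice_width_le (@a_vertex R) (critical_dual kv) (critical_neq0 kv)) _.
apply: le_lt_trans (width_le (i := Ordinal top4) (j := Ordinal bot4) _) _.
  move=> i; have /andP[lo hi] : ordered k i by apply: ord; rewrite mem_iota /=.
  rewrite -[X in X && _]subr_ge0 -[X in _ && X]subr_ge0 !critical_form_vertex /=.
  have c_gt0 : 0 < 38 / pval x det by apply: (divr_gt0 _ d0); rewrite ltr0n.
  by rewrite !(pmulr_rge0 _ c_gt0) (pval_ge0 coord_le1 hi) (pval_ge0 coord_le1 lo).
rewrite critical_form_vertex /= mulrAC ltr_pdivrMr //.
rewrite -subr_gt0 -(pval_gap det (rise k (top k) (bottom k))).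
exact: gap_gt0.
Qed.

Lemma combination_le0 ks : all valid_critical ks ->
  ~ (exists2 k, valid_critical k & 0 < pval x (gap k)) ->
  pval x (combination ks) <= 0.
Proof.
move=> ksv gap_le0; elim: ks ksv => [|k ks IHk] /=; first by rewrite /pval big_nil.
move=> /andP[kv /IHk ks0]; rewrite pvalD pvalM -oppr_ge0 opprD addr_ge0 ?oppr_ge0 //.
apply: mulr_ge0_le0; last by rewrite leNgt; apply/negP => gk; apply: gap_le0; exists k.
by have /and5P[_ _ _ _ /andP[_ /(pval_ge0 coord_le1)]] := kv.
Qed.

Lemma sum_squares_ge0 qs : 0 <= pval x (sum_squares qs).
Proof.
elim: qs => [|q qs IHq] /=; first by rewrite /pval big_nil.
rewrite pvalD addr_ge0 // 2!pvalM -expr2 mulr_ge0 ?sqr_ge0 // pval_constZ.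
by rewrite zval_ge0 //; lia.
Qed.

Lemma pval_gt0_of_sub p q : 0 <= pval x q -> 0 < pval x (psub p q) -> 0 < pval x p.
Proof. by rewrite pvalB subr_gt0; exact: le_lt_trans. Qed.

Lemma some_gap_gt0 : exists2 k, valid_critical k & 0 < pval x (gap k).
Proof.
have [//|/(combination_le0 criticals_valid)] :=
  pselect (exists2 k, valid_critical k & 0 < pval x (gap k)).
have comb_gt0 := pval_gt0_of_sub (sum_squares_ge0 squares)
  (positive_definiteP coord_le1 combination_positive_definite coord_neq0).
by move=> /(lt_le_trans comb_gt0); rewrite ltxx.
Qed.

Lemma width_decreases : lattice_width (Lambda s) (@Delta R) < w.
Proof. by have [k kv /(critical_width kv)] := some_gap_gt0. Qed.

End Perturbation.

Lemma width_unperturbed (R : realType) :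
  2 + Num.sqrt 2 <= lattice_width (Lambda 0) (@Delta R).
Proof.
apply: lattice_width_ge => [|f fL f0].
  have s_le i : `|(0 : 'rV[R]_8) 0 i| <= 38^-1 by rewrite mxE normr0 invr_ge0.
  have [k kv] : exists k, valid_critical k.
    by have /= /andP[kv _] := criticals_valid; eexists; exact: kv.
  exists (width (@Delta R) (critical_functional 0 k)), (critical_functional 0 k) => //.
  by split; [exact: critical_dual | exact: critical_neq0].
have [i [j ij]] := wide_edge fL f0.
by apply: le_trans ij _; exact: edge_le_width.
Qed.

Theorem theorem4p3 (R : realType) (s : 'rV[R]_8) (s_neq0 : s <> 0)
    (s_small : `|s| < 2614 / 10 ^+ 5) :
  lattice_width (Lambda 0) (@Delta R) > lattice_width (Lambda s) (@Delta R).
Proof.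
apply: lt_le_trans (width_unperturbed R).
apply: (width_decreases s_neq0) => i.
have : `|s 0 i| <= `|s|.
  rewrite [leRHS]mx_normrE.
  exact: (le_bigmax _ (fun ij : 'I_1 * 'I_8 => `|s ij.1 ij.2|) (0, i)).
(* 2614 / 10 ^ 5 < 38^-1 *)
lra.
Qed.
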